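(* Let $j$ be a positive even integer and let $G$ be a connected graph with non-empty bridge set $B(G)$. If there is no bridge $b\in B(G)$ such that $G-\{b\}$ has a component that is bipartite or isomorphic to $K_1$, then $\zeta_{2j}(G)\le 6$. Otherwise (i.e. if for some bridge $b$ the graph $G-\{b\}$ has a component that is bipartite or isomorphic to $K_1$), there is no finite non-trivial abelian group $\mathbb{A}$ such that $G$ is zero-sum $\mathbb{A}$-magic.
   Context: Graphs are finite and loopless, but may have multiple edges. A bridge is an edge whose deletion results in a graph with exactly one more component than $G$; $B(G)$ is the set of bridges of $G$. For a non-trivial abelian group $\mathbb{A}$ (written additively, identity $0$), a graph $G$ is zero-sum $\mathbb{A}$-magic if there is a function $\phi: E(G)\to \mathbb{A}\setminus\{0\}$ such that for every vertex $v$ the sum of $\phi(e)$ over all edges $e$ incident to $v$ is $0$. $\mathbb{Z}_n$ is the group of integers modulo $n$, and $\mathbb{Z}_n^k$ is the direct product of $k$ copies of it. For $j\ge 1$, $\zeta_{2j}(G)$ is the smallest positive integer $c$ such that $G$ is zero-sum $\mathbb{Z}_{2j}^c$-magic if such $c$ exists, and $\infty$ otherwise. *)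

(* Defs.v *)
From HB Require Import structures.
From mathcomp Require Import all_boot all_order all_algebra.
From mathcomp Require Import boolp.

Set Implicit Arguments.
Unset Strict Implicit.
Unset Printing Implicit Defensive.

Import GRing.Theory.

(* Finite loopless multigraphs: distinct elements of [edge] may have the same
   set of ends. *)
Record mgraph := MGraph {
  vertex : finType;
  edge : finType;
  ends : edge -> {set vertex};
  card_ends : forall e, #|ends e| = 2 }.

Definition adj (G : mgraph) : rel (vertex G) :=
  fun x y => [exists e : edge G, ends e == [set x; y]].

Definition components (G : mgraph) : {set {set vertex G}} :=
  equivalence_partition (connect (@adj G)) [set: vertex G].

Definition connected_graph (G : mgraph) : Prop := #|components G| = 1.

Section Deletion.
Variables (G : mgraph) (b : edge G).

Definition del_ends (e : {e : edge G | e != b}) : {set vertex G} :=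
  ends (val e).

Lemma card_del_ends e : #|del_ends e| = 2.
Proof. exact: card_ends. Qed.

Definition del_edge : mgraph := MGraph card_del_ends.
End Deletion.

Section Induced.
Variables (G : mgraph) (S : {set vertex G}).

Definition ind_ends (e : {e : edge G | ends e \subset S}) :
  {set {v : vertex G | v \in S}} := [set v | val v \in ends (val e)].

Lemma card_ind_ends e : #|ind_ends e| = 2.
Proof.
rewrite -(card_ends (val e)) -(card_imset _ val_inj); congr #|pred_of_set _|.
apply/setP=> x; apply/imsetP/idP => [[v]|xe]; first by rewrite inE => ? ->.
have xS := subsetP (valP e) x xe.
by exists (exist _ x xS); rewrite ?inE.
Qed.

Definition induced : mgraph := MGraph card_ind_ends.
End Induced.

Definition is_bridge (G : mgraph) (b : edge G) : Prop :=
  #|components (del_edge b)| = #|components G|.+1.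

Definition bipartite (G : mgraph) : Prop :=
  exists X : {set vertex G}, forall e : edge G,
    #|ends e :&: X| = 1 /\ #|ends e :&: ~: X| = 1.

Definition graph_iso (G H : mgraph) : Prop :=
  exists (f : vertex G -> vertex H) (g : edge G -> edge H),
    [/\ bijective f, bijective g & forall e, ends (g e) = f @: ends e].

Definition K1_ends (e : void) : {set unit} := match e with end.

Lemma card_K1_ends e : #|K1_ends e| = 2.
Proof. by case: e. Qed.

Definition K1 : mgraph := MGraph card_K1_ends.

Definition has_bip_or_K1_component (G : mgraph) : Prop :=
  exists2 S : {set vertex G}, S \in components G &
    bipartite (induced S) \/ graph_iso (induced S) K1.

Definition zero_sum_magic (A : zmodType) (G : mgraph) : Prop :=
  exists phi : edge G -> A,
    (forall e, phi e <> 0%R) /\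
    (forall v : vertex G, (\sum_(e : edge G | v \in ends e) phi e)%R = 0%R).

Definition zeta_pred (j : nat) (G : mgraph) : pred nat :=
  fun c => (0 < c) && `[< zero_sum_magic {ffun 'I_c -> 'Z_(2 * j)} G >].

(* This is zeta_{2j}(G), with [None] standing for infinity.  It is meant for
   [0 < j] only, since ['Z_0] is Z/2 in MathComp. *)
Definition zeta (j : nat) (G : mgraph) : option nat :=
  match pselect (exists c, zeta_pred j G c) with
  | left ex_c => Some (ex_minn ex_c)
  | right _ => None
  end.

Definition zeta_le (z : option nat) (m : nat) : bool :=
  if z is Some c then c <= m else false.

(* Main.v *)
(* If deleting the bridge [b] leaves a bipartite component [S], then adding the
   vertex sums over one colour class of [S] and subtracting those over the other
   leaves only plus or minus the label of [b], which is therefore zero.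

   Otherwise six coordinates over Z/2j, with 4 | 2j, are filled as follows.  By
   the 8-flow theorem, proved along the lines of Seymour's argument for the
   6-flow theorem, three even edge sets cover all edges that are not bridges;
   label them by the element [j] of order two.  For the bridges, contract each
   block (component of the graph without its bridges), identifying all
   non-bipartite blocks with a single vertex.  By hypothesis this contracted
   graph has no bridge, so again three even sets of bridges cover everything.
   Each of them, labelled by [j = 2q], extends to a zero-sum labelling: a
   bipartite block sees an even number of these bridges, so their excess can be
   cancelled along paths; in a non-bipartite block a remaining excess [2q] is
   absorbed by an odd closed walk with alternating labels [q], [-q]. *)
Require Import Defs.
From HB Require Import structures.
From mathcomp Require Import all_boot all_order all_algebra.
From mathcomp Require Import boolp.

Set Implicit Arguments.
Unset Strict Implicit.
Unset Printing Implicit Defensive.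

(** * Boundaries, edge cuts and walks *)

Section Boundary.
Import GRing.Theory.
Local Open Scope ring_scope.
Variables (V E : finType) (s t : E -> V).
Implicit Types (A : zmodType) (S X Y W : {set V}) (D K : {set E}) (x y z v w : V).

(** The functions [s] and [t] order the ends of each edge arbitrarily, and a loop counts twice,
    since contraction may create loops. Over [bool], whose addition is exclusive or, zero boundary
    means an even edge set. *)
Definition boundary A (u : E -> A) v : A :=
  \sum_e (u e *+ (s e == v) + u e *+ (t e == v)).

Definition edge_cut S : {set E} := [set e | (s e \in S) (+) (t e \in S)].

Notation bd := boundary.
Notation cut := edge_cut.

Definition link x e y :=
  ((s e == x) && (t e == y)) || ((s e == y) && (t e == x)).

Inductive walk D : V -> seq E -> V -> Prop :=
| walk_nil x : walk D x [::] x
| walk_cons x e y p z :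
    e \in D -> link x e y -> walk D y p z -> walk D x (e :: p) z.

Lemma bdD A (u w : E -> A) v : bd (fun e => u e + w e) v = bd u v + bd w v.
Proof.
rewrite /boundary -big_split /=; apply: eq_bigr => e _.
by rewrite !mulrnDl addrACA.
Qed.

Lemma bd_sum A (I : finType) (P : pred I) (u : I -> E -> A) v :
  bd (fun e => \sum_(i | P i) u i e) v = \sum_(i | P i) bd (u i) v.
Proof.
rewrite exchange_big /=; apply: eq_bigr => e _.
by rewrite big_split /= !sumrMnl.
Qed.

Lemma bd_comp A A' (f : A -> A') (u : E -> A) v :
  f 0 = 0 -> {morph f : a b / a + b} -> bd (f \o u) v = f (bd u v).
Proof.
move=> f0 fD; rewrite /boundary (big_morph f fD f0); apply: eq_bigr => e _.
have fn (a : A) (b : bool) : f (a *+ b) = f a *+ b by case: b; rewrite ?mulr1n.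
by rewrite fD !fn.
Qed.

Lemma bd_eq A (u w : E -> A) v :
  (forall e, (s e == v) || (t e == v) -> u e = w e) -> bd u v = bd w v.
Proof.
move=> uw; apply: eq_bigr => e _; case: (eqVneq (s e) v) (uw e) => /= [_ ->//|_].
by case: eqP => [_ ->|].
Qed.

Lemma bd_eq0 A (u : E -> A) v :
  (forall e, (s e == v) || (t e == v) -> u e = 0) -> bd u v = 0.
Proof.
move=> u0; rewrite (@bd_eq _ _ (fun=> 0)) // /bd big1 // => e _.
by rewrite !mul0rn addr0.
Qed.

Lemma sum_indic A S (a : A) x : \sum_(v in S) a *+ (x == v) = a *+ (x \in S).
Proof.
case: (boolP (x \in S)) => xS.
  rewrite (bigD1 x) //= eqxx big1 ?addr0 // => v /andP[_].
  by rewrite eq_sym => /negPf ->.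
by rewrite big1 // => v vS; case: eqP xS => // ->; rewrite vS.
Qed.

Lemma sum_bd A S (u : E -> A) :
  \sum_(v in S) bd u v = \sum_e (u e *+ (s e \in S) + u e *+ (t e \in S)).
Proof.
rewrite exchange_big /=; apply: eq_bigr => e _.
by rewrite big_split /= !sum_indic.
Qed.

Lemma sum_bd_cut A S (u : E -> A) : (forall a : A, a + a = 0) ->
  \sum_(v in S) bd u v = \sum_(e in cut S) u e.
Proof.
move=> A2; rewrite sum_bd [RHS]big_mkcond; apply: eq_bigr => e _; rewrite inE.
by case: (s e \in S); case: (t e \in S); rewrite /= ?addr0 ?add0r.
Qed.

Lemma linkC x e y : link x e y = link y e x.
Proof. by rewrite /link orbC. Qed.

Lemma linkP x e y :
  reflect ((s e = x /\ t e = y) \/ (s e = y /\ t e = x)) (link x e y).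
Proof.
by apply: (iffP orP) => -[] => [/andP[/eqP ? /eqP ?]|/andP[/eqP ? /eqP ?]|[-> ->]|[-> ->]];
  [left|right|left|right]; rewrite ?eqxx.
Qed.

Lemma bd_delta A (a : A) x e y v :
  link x e y -> bd (fun e' => a *+ (e' == e)) v = a *+ (x == v) + a *+ (y == v).
Proof.
move=> exy; rewrite /boundary (bigD1 e) //= big1 => [|e' /negPf ->]; last first.
  by rewrite !mul0rn addr0.
rewrite eqxx mulr1n addr0.
by case/linkP: exy => -[-> ->] //; rewrite addrC.
Qed.

Lemma cutP S e : reflect (exists x y, [/\ link x e y, x \in S & y \notin S]) (e \in cut S).
Proof.
rewrite inE; apply: (iffP idP) => [|[x [y [/linkP[[-> ->]|[-> ->]] -> /negPf ->]]]] //.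
case: (boolP (s e \in S)) => sS /= tS.
  by exists (s e), (t e); split=> //; apply/linkP; left.
by exists (t e), (s e); split=> //; apply/linkP; right.
Qed.

Lemma cutC S : cut (~: S) = cut S.
Proof. by apply/setP=> e; rewrite !inE addbN addNb negbK. Qed.

Lemma cut_addb S X Y : (forall v, (v \in Y) = (v \in S) (+) (v \in X)) ->
  forall e, (e \in cut Y) = (e \in cut S) (+) (e \in cut X).
Proof. by move=> YE e; rewrite !inE !YE addbACA. Qed.

Lemma walk_cat D x p y q z : walk D x p y -> walk D y q z -> walk D x (p ++ q) z.
Proof.
elim=> {x p y} //= x e y' p y eD exy _ IH qw.
exact: walk_cons eD exy (IH qw).
Qed.

Lemma walk1 D x e y : e \in D -> link x e y -> walk D x [:: e] y.
Proof. by move=> eD exy; apply: walk_cons exy _ => //; apply: walk_nil. Qed.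

Lemma walk_rev D x p y : walk D x p y -> walk D y (rev p) x.
Proof.
elim=> [z|{}x e {}y {}p z eD exy _ IH]; first exact: walk_nil.
by rewrite rev_cons -cats1; apply: walk_cat IH (walk1 _ _); rewrite // linkC.
Qed.

Lemma walk_sub D x p y e : walk D x p y -> e \in p -> e \in D.
Proof.
elim=> {x y p} // x e' y p z eD _ _ IH; rewrite inE => /predU1P[->|] //.
Qed.

Lemma walk_mono D K x p y :
  walk D x p y -> (forall e, e \in p -> e \in K) -> walk K x p y.
Proof.
elim=> {x y p} [x _|x e y p z _ exy _ IH sub]; first exact: walk_nil.
apply: walk_cons exy (IH _); first by apply: sub; rewrite mem_head.
by move=> e' e'p; apply: sub; rewrite inE e'p orbT.
Qed.

Lemma walk_split D x p z e v y : walk D x p z -> e \in p -> link v e y ->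
  exists p1 p2, [/\ p = p1 ++ p2, walk D x p1 v & walk D v p2 z].
Proof.
elim=> {x p z} // x e' y' p z e'D e'xy pw IH; rewrite inE.
case/predU1P=> [-> evy|ep evy].
  have [->|vy'] : v = x \/ v = y'.
    by case/linkP: e'xy evy => -[<- <-] /linkP[] [? ?]; auto.
    by exists [::], (e' :: p); split=> //; [apply: walk_nil | apply: walk_cons e'xy pw].
  by exists [:: e'], p; rewrite vy'; split=> //; apply: walk1.
have [p1 [p2 [-> w1 w2]]] := IH ep evy.
by exists (e' :: p1), p2; split=> //; apply: walk_cons e'xy w1.
Qed.

(** If [e] recurs in the trail [q], then [q] passes through [x], and its part from there on replaces
    the whole walk. *)
Lemma walk_uniq D x p z : walk D x p z -> exists2 q, uniq q & walk D x q z.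
Proof.
elim=> {x p z} [x|x e y p z eD exy _ [q uq qw]].
  by exists [::] => //; apply: walk_nil.
case: (boolP (e \in q)) => eq; last first.
  by exists (e :: q); rewrite /= ?eq //; apply: walk_cons exy qw.
have [p1 [p2 [qE _ w2]]] := walk_split qw eq exy.
by exists p2 => //; move: uq; rewrite qE cat_uniq => /and3P[].
Qed.

Definition walk_vertices x (p : seq E) : {set V} :=
  [set v | (v == x) || has (fun e => (s e == v) || (t e == v)) p].

Lemma link_ends e v : (s e == v) || (t e == v) -> exists y, link v e y.
Proof.
case/orP=> /eqP <-; first by exists (t e); apply/linkP; left.
by exists (s e); apply/linkP; right.
Qed.

Lemma walk_verticesP D x p z v : walk D x p z -> v \in walk_vertices x p ->
  exists p1 p2, [/\ p = p1 ++ p2, walk D x p1 v & walk D v p2 z].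
Proof.
move=> pw; rewrite inE => /predU1P[->|/hasP[e ep /link_ends[y evy]]].
  by exists [::], p; split=> //; apply: walk_nil.
exact: walk_split pw ep evy.
Qed.

(* Values alternate in sign along the walk, so in an odd closed walk the two
   contributions at the base point add up instead of cancelling. *)
Lemma walk_chain A D x p y : walk D x p y -> forall a : A,
  exists u : E -> A,
  [/\ forall e, e \notin p -> u e = 0,
      forall v, bd u v =
        a *+ (x == v) + (if odd (size p) then a else - a) *+ (y == v)
    & uniq p -> forall e, e \in p -> u e = a \/ u e = - a].
Proof.
elim=> {x p y} [x a|x e y p z eD exy _ IH a].
  exists (fun=> 0); split=> // v; rewrite mulNrn addrN bd_eq0 //.
have [u [u0 bdu uE]] := IH (- a).
exists (fun e' => a *+ (e' == e) + u e'); split=> [e'|v|/= /andP[ep up] e'].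
- by rewrite inE negb_or => /andP[/negPf -> /u0 ->]; rewrite addr0.
- rewrite bdD bdu (bd_delta _ _ exy) mulNrn addrA addrK /=.
  by case: (odd _) => /=; rewrite ?opprK.
rewrite inE; case: eqP => [-> _|_ /= /uE[] // ->]; first by rewrite u0 ?addr0; auto.
  by rewrite add0r; auto.
by rewrite add0r opprK; auto.
Qed.

(** Each [m y] travels along its walk to [r y]; as [- m y = m y], the parity of the walk does not
    affect what arrives. *)
Lemma gather_boundary A D (r : V -> V) (m : V -> A) :
  (forall y, m y != 0 -> exists p, walk D y p (r y)) ->
  (forall y, - m y = m y) ->
  exists w : E -> A, [/\ forall e, e \notin D -> w e = 0 &
    forall v, bd w v = m v + \sum_(y | r y == v) m y].
Proof.
move=> rw mN.
have /choice[u uP] (y : V) : exists u : E -> A, 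
    [/\ forall e, e \notin D -> u e = 0 &
        forall v, bd u v = m y *+ (y == v) + m y *+ (r y == v)].
  have [my0|/rw[p pw]] := eqVneq (m y) 0.
    exists (fun=> 0); split=> // v; rewrite my0 !mul0rn addr0 bd_eq0 //.
  have [u [u0 bdu _]] := walk_chain pw (m y); exists u; split=> [e eD|v].
    by apply: u0; apply: contra eD; apply: walk_sub pw.
  by rewrite bdu mN if_same.
exists (fun e => \sum_y u y e); split=> [e eD|v].
  by rewrite big1 // => y _; case: (uP y) => u0 _; apply: u0.
rewrite bd_sum (eq_bigr _ (fun y _ => proj2 (uP y) v)) big_split /=; congr (_ + _).
  rewrite (bigD1 v) //= eqxx big1 ?addr0 // => y /negPf -> //.
by rewrite [RHS]big_mkcond; apply: eq_bigr => y _; case: (r y == v).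
Qed.

(** * Edge-disjoint walks *)

Lemma first_hit D x q y (P : {set V}) :
  walk D x q y -> y \in P -> uniq q ->
  exists q1 w, [/\ walk D x q1 w, w \in P, uniq q1, {subset q1 <= q} &
    forall e, e \in q1 -> (s e \notin P) || (t e \notin P)].
Proof.
elim=> {x q y} [x xP _|x e z q y eD l _ IH yP /= /andP[eq uq]].
  by exists [::], x; split=> //; apply: walk_nil.
have [xP|xP] := boolP (x \in P).
  by exists [::], x; split=> //; apply: walk_nil.
have [q1 [w [w1 wP uq1 sub q1P]]] := IH yP uq.
exists (e :: q1), w; split=> //.
- exact: walk_cons l w1.
- by rewrite /= uq1 (contra (sub e)).
- by move=> e'; rewrite !inE => /predU1P[->|/sub ->]; rewrite ?eqxx ?orbT.
move=> e'; rewrite inE => /predU1P[->|/q1P //].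
by case/linkP: l => -[-> ->]; rewrite xP ?orbT.
Qed.

(* The edge form of Menger's theorem for two paths. *)
Lemma two_disjoint_walks (K : {set E}) X y :
  (forall e, e \in K -> s e \in X /\ t e \in X) ->
  (forall Y, Y \subset X -> Y != set0 -> Y != X -> (1 < #|cut Y :&: K|)%N) ->
  y \in X -> forall z, z \in X ->
  exists p1 p2, [/\ walk K y p1 z, walk K z p2 y & uniq (p1 ++ p2)].
Proof.
move=> KX cutK yX.
(* If the vertices satisfying [T] do not fill [X], some edge [e] leaves their set, and a closed
   trail through its end [u] can be rerouted through its other end [z]. *)
pose T z := exists p1 p2, [/\ walk K y p1 z, walk K z p2 y & uniq (p1 ++ p2)].
have Ty : T y by exists [::], [::]; split=> //; apply: walk_nil.
pose S := [set z in X | `[< T z >]].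
have SX : S \subset X by apply/subsetP=> z; rewrite inE => /andP[].
have [SE z|SnX] := eqVneq S X; first by rewrite -SE inE => /andP[_ /asboolP].
have S0 : S != set0 by apply/set0Pn; exists y; rewrite inE yX; apply/asboolP.
have KXl e x w : e \in K -> link x e w -> (x \in X) /\ (w \in X).
  by move=> /KX[? ?] /linkP[] [<- <-].
have /card_gt0P[e] : (0 < #|cut S :&: K|)%N by apply: ltnW; apply: cutK.
rewrite inE => /andP[/cutP[u [z [uez uS zS]]] eK].
have [uX zX] := KXl _ _ _ eK uez.
have nTz : ~ T z by move=> Tz; case/negP: zS; rewrite inE zX; apply/asboolP.
have [p1 [p2 [w1 w2 up]]] : T u by move: uS; rewrite inE => /andP[_ /asboolP].
have pw := walk_cat w1 w2.
pose P := walk_vertices y (p1 ++ p2).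
have zP : z \notin P.
  apply/negP=> /(walk_verticesP pw)[q1 [q2 [pE ? ?]]]; apply: nTz.
  by exists q1, q2; rewrite -pE.
have eP : e \notin p1 ++ p2.
  apply: contra zP => ep; rewrite inE; apply/orP; right; apply/hasP; exists e => //.
  by case/linkP: uez => -[-> ->]; rewrite eqxx ?orbT.
(* Otherwise the vertices reachable from [z] without [e] form a set whose cut in [K] contains at
   most [e]. *)
have [q qw] : exists q, walk (K :\ e) z q y.
  pose Z := [set v | `[< exists q, walk (K :\ e) z q v >]].
  have Zstep v e' v' : v \in Z -> e' \in K -> e' != e -> link v e' v' -> v' \in Z.
    rewrite !inE => /asboolP[q qw] e'K e'e l; apply/asboolP; exists (q ++ [:: e']).
    by apply: walk_cat qw (walk1 _ l); rewrite !inE e'e.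
  have [|yZ] := boolP (y \in Z); first by rewrite inE => /asboolP.
  have zZ : z \in Z by rewrite inE; apply/asboolP; exists [::]; apply: walk_nil.
  have ZX : Z \subset X.
    apply/subsetP=> v; rewrite inE => /asboolP[q qw]; move: zX.
    elim: qw => {q v zZ Zstep yZ zP zS uez nTz} // x e' y' q v + l _ IH _.
    by rewrite in_setD1 => /andP[_ e'K]; apply: IH; case: (KXl _ _ _ e'K l).
  suff : (#|cut Z :&: K| <= 1)%N.
    rewrite leqNgt cutK //; first by apply/set0Pn; exists z.
    by apply: contraNneq yZ => ->.
  rewrite -(cards1 e); apply: subset_leq_card; apply/subsetP=> e'.
  rewrite in_setI in_set1 => /andP[/cutP[v [v' [l vZ v'Z]]] e'K].
  by apply: contraNT v'Z => e'e; apply: Zstep l.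
have [{}q uq {}qw] := walk_uniq qw.
have yP : y \in P by rewrite inE eqxx.
have [q1 [w [q1w wP uq1 _ q1P]]] := first_hit qw yP uq.
have eq1 : e \notin q1 by apply/negP=> /(walk_sub q1w); rewrite !inE eqxx.
have q1K : walk K z q1 w.
  by apply: (walk_mono q1w) => e1 e1q; have := walk_sub q1w e1q; rewrite in_setD1 => /andP[].
have disj e' : e' \in q1 -> e' \notin p1 ++ p2.
  move=> /q1P; apply: contraL => e'p; rewrite negb_or !negbK !inE.
  by apply/andP; split; apply/orP; right; apply/hasP; exists e'; rewrite // eqxx ?orbT.
have uniq_new l p : subseq p (p1 ++ p2) -> perm_eq l (e :: q1 ++ p) -> uniq l.
  move=> sub /perm_uniq ->.
  rewrite /= mem_cat negb_or eq1 (contra (@mem_subseq _ _ _ sub e)) //= cat_uniq uq1.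
  rewrite (subseq_uniq sub up) andbT.
  by apply/hasPn=> e' /(mem_subseq sub); apply: contraL => /disj.
(* The walk from [z] first meets the old trail at [w]. If [w] lies on [p1], go along [p2] backwards
   to [u] and over [e] to [z], then home by [q1] and the reverse of [a]. *)
have split1 a b : p1 = a ++ b -> walk K y a w -> walk K w b u -> T z.
  move=> p1E aw bw; exists (rev p2 ++ [:: e]), (q1 ++ rev a); split.
  - exact: walk_cat (walk_rev w2) (walk1 eK uez).
  - exact: walk_cat q1K (walk_rev aw).
  apply: (uniq_new _ (a ++ p2)); first by rewrite p1E cat_subseq ?prefix_subseq.
  by apply/permP=> f; rewrite /= !count_cat !count_rev /= addn0
     addnC [RHS]addnC !addnA.
have split2 a b : p2 = a ++ b -> walk K u a w -> walk K w b y -> T z.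
  move=> p2E aw bw; exists (p1 ++ [:: e]), (q1 ++ b); split.
  - exact: walk_cat w1 (walk1 eK uez).
  - exact: walk_cat q1K bw.
  apply: (uniq_new _ (p1 ++ b)); first by rewrite p2E cat_subseq ?suffix_subseq.
  by apply/permP=> f; rewrite /= !count_cat /= addn0
     [X in (X + _)%N]addnC -addnA; congr (_ + _)%N; rewrite addnCA.
case: nTz; move: wP; rewrite inE has_cat => /or3P[/eqP wy|wp1|wp2].
- by apply: (split1 [::] p1); rewrite ?wy //; apply: walk_nil.
- have wv : w \in walk_vertices y p1 by rewrite inE wp1 orbT.
  have [a [b [p1E aw bw]]] := walk_verticesP w1 wv; exact: split1 p1E aw bw.
have wv : w \in walk_vertices u p2 by rewrite inE wp2 orbT.
have [a [b [p2E aw bw]]] := walk_verticesP w2 wv; exact: split2 p2E aw bw.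
Qed.

(** * The 8-flow theorem *)

Section EightFlow.
Variables (A : zmodType).
Hypothesis A2 : forall a : A, a + a = 0.
Hypothesis A3 : forall a b : A, exists c, c != a /\ c != b.
Variable D : {set E}.
Hypothesis D_cut : forall S, #|cut S :&: D| != 1%N.

(* The state of Seymour's construction when the vertex set [W] has been
   absorbed: [h] and [u] jointly have no zero on the edges that leave or avoid
   [W], and conservation of [u] is required outside [Y] only. *)
Definition flow_off W (h : E -> bool) (u : E -> A) (Y : {set V}) :=
  [/\ forall e, h e -> [/\ e \in D, s e \notin W & t e \notin W],
      forall e, e \notin D -> u e = 0,
      forall v, bd h v = 0,
      forall v, v \notin Y -> bd u v = 0
    & forall e, e \in D -> (s e \notin W) || (t e \notin W) ->
        ~~ h e -> u e != 0].

Lemma char2N (a : A) : - a = a.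
Proof. by apply/eqP; rewrite eq_sym -addr_eq0 A2. Qed.

(** The trail joins the even set [h], so [u] may take any values on it. Edges inside
    [W :|: walk_vertices y p] but not inside [W] need not be nonzero so far: they receive the
    constant [a0], and the resulting excess is carried along the trail to [y], the one new vertex
    where conservation may fail. *)
Lemma absorb_trail W y p h' u' : walk D y p y -> uniq p ->
  [disjoint walk_vertices y p & W] ->
  flow_off (W :|: walk_vertices y p) h' u' (W :|: walk_vertices y p) ->
  exists h u, flow_off W h u (y |: W) /\ {subset p <= h}.
Proof.
move=> pw up /disjoint_setI0; set Y := walk_vertices y p => YW.
have [a0 a0N0] : exists a0 : A, a0 != 0 by have [a0 []] := A3 0 0; exists a0.
case=> h'D u'D bdh' bdu' nz.
have pY e : e \in p -> (s e \in Y) /\ (t e \in Y).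
  by move=> ep; rewrite !inE; split; apply/orP; right; apply/hasP; exists e; rewrite // eqxx ?orbT.
have YnW v : v \in Y -> v \notin W.
  by move=> vY; apply/negP=> vW; have := in_setI v Y W; rewrite YW vY vW in_set0.
have [hp [hp0 bdhp hp1]] := walk_chain pw true.
have {hp1}hpE e : hp e = (e \in p).
  have [ep|/hp0//] := boolP (e \in p); by case: (hp1 up e ep).
pose u0 e := if [&& e \in D, (s e \in W :|: Y) && (t e \in W :|: Y)
  & ~~ ((s e \in W) && (t e \in W))] then a0 else u' e.
have bdu0 v : v \notin W :|: Y -> bd u0 v = 0.
  move=> vWY; rewrite -[RHS](bdu' v vWY); apply: bd_eq => e ev; rewrite /u0.
  by case/orP: ev => /eqP ->; rewrite (negPf vWY) /= ?andbF.
have [|z|w [w0 bdw]] := @gather_boundary A [set e in p] (fun=> y) (fun v => bd u0 v *+ (v \in Y)).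
- move=> z; case: (boolP (z \in Y)) => [zY _|_]; last by rewrite mulr0n eqxx.
  have [p1 [p2 [pE _ w2]]] := walk_verticesP pw zY.
  exists p2; apply: (walk_mono w2) => e ep; rewrite inE pE mem_cat ep orbT //.
- exact: char2N.
exists (fun e => h' e + hp e), (fun e => u0 e + w e); split; last first.
  move=> e ep; rewrite /in_mem /= hpE ep; case: (boolP (h' e)) => // /h'D[_].
  by rewrite in_setU (proj1 (pY e ep)) orbT.
split=> [e|e eD|v|v|e eD eW].
- rewrite hpE; have [ep _|ep] := boolP (e \in p).
    by have [/YnW ? /YnW ?] := pY e ep; split=> //; apply: walk_sub pw ep.
  by rewrite addr0 => /h'D[? ]; rewrite !in_setU !negb_or => /andP[? _] /andP[].
- rewrite /u0 (negPf eD) /= u'D // w0 ?addr0 // inE.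
  by apply: contra eD; apply: walk_sub pw.
- by rewrite bdD bdh' bdhp add0r; case: (odd _); case: (y == v).
- rewrite in_setU1 negb_or => /andP[vy vW]; rewrite bdD bdw.
  rewrite big1 ?addr0 => [|z yv]; last by rewrite eq_sym yv in vy.
  case: (boolP (v \in Y)) => vY; first by rewrite A2.
  by rewrite bdu0 ?addr0 // in_setU negb_or vW.
rewrite hpE; have [ep|ep] := boolP (e \in p).
  case: (boolP (h' e)) => // /h'D[_].
  by rewrite in_setU (proj1 (pY e ep)) orbT.
rewrite addr0 w0 ?inE // addr0 /u0 eD /=.
case: ifP => [//|/negbT]; rewrite [X in _ && X]negb_and eW andbT negb_and => eWY.
exact: nz.
Qed.

(** Induction on the complement of [W]: absorb a closed trail, possibly trivial, from a suitable
    part of it, then restore conservation at its base, if need be by an edge into [W], where no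
    conservation is required. *)
Lemma flow_off_exists n W : (#|~: W| <= n)%N -> exists h u, flow_off W h u W.
Proof.
elim: n W => [|n IH] W.
  rewrite leqn0 cards_eq0 => /eqP /setP W0.
  have inW v : v \in W by have := W0 v; rewrite !inE => /negbFE.
  exists (fun=> false), (fun=> 0); split=> //.
  - by move=> v; rewrite bd_eq0.
  - by move=> v; rewrite inW.
  by move=> e _; rewrite !inW.
move=> Wn; have [W0|WN0] := posnP #|~: W|; first by apply: IH; rewrite W0.
have step y p : walk D y p y -> uniq p -> [disjoint walk_vertices y p & W] ->
    exists h u, flow_off W h u (y |: W) /\ {subset p <= h}.
  move=> pw up dis; have [|h' [u' hu']] := IH (W :|: walk_vertices y p).
    rewrite -ltnS; apply: leq_trans Wn; apply: proper_card; rewrite setCU.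
    rewrite properE subsetIl /=; apply/subsetPn; exists y.
      rewrite inE; apply/negP=> yW; move/disjoint_setI0/setP/(_ y): dis.
      by rewrite !inE eqxx yW.
    by rewrite !inE eqxx /= andbF.
  exact: absorb_trail hu'.
(* For [X] minimal in the complement of [W] with at most one edge from [X] to
   the rest of that complement, the edges inside [X] form a connected bridgeless
   graph. *)
pose out X := [set e in cut X :&: D | (s e \notin W) && (t e \notin W)].
pose P X := [&& X != set0, X \subset ~: W & (#|out X| <= 1)%N].
have [|X /minsetP[/and3P[X0 XW Xout] Xmin]] := @ex_minset _ P.
  exists (~: W); rewrite /P subxx -card_gt0 WN0 /=.
  rewrite (_ : out _ = set0) ?cards0 //; apply/setP=> e; rewrite !inE.
  by case: (s e \in W); case: (t e \in W); rewrite ?andbF.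
have XnW v : v \in X -> v \notin W by move/(subsetP XW); rewrite inE.
have sumX (C : zmodType) (u : E -> C) : (forall a : C, a + a = 0) ->
    (forall e, e \notin D -> u e = 0) ->
    \sum_(v in X) bd u v = \sum_(e in cut X :&: D) u e.
  move=> C2 uD; rewrite sum_bd_cut // (big_setID D) /= [X in _ + X]big1 ?addr0 //.
  by move=> e; rewrite inE => /andP[/uD].
pose K := [set e in D | (s e \in X) && (t e \in X)].
(* If at most one edge of [K] left [Y], then [Y] or [X :\: Y], whichever avoids the only possible
   edge of [out X], would contradict the minimality of [X]. *)
have cutK Y : Y \subset X -> Y != set0 -> Y != X -> (1 < #|cut Y :&: K|)%N.
  move=> YX Y0 YnX; rewrite ltnNge; apply/negP=> cY.
  have outY (Z : {set V}) e : Z \subset X -> e \in out Z ->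
      (e \in cut Z :&: K) || (e \in out X) && ((s e \in Z) || (t e \in Z)).
    move=> /subsetP ZX; have := (ZX (s e), ZX (t e)); rewrite !inE.
    case: (s e \in Z); case: (t e \in Z); rewrite ?andbF //= => -[].
      move=> /(_ isT) -> _ /and3P[-> -> ->]; case: (t e \in X) => //=.
    move=> _ /(_ isT) -> /and3P[-> -> ->]; case: (s e \in X) => //=.
  have noZ (Z : {set V}) : Z \subset X -> Z != set0 -> (#|cut Z :&: K| <= 1)%N ->
      (forall e, e \in out X -> (s e \notin Z) && (t e \notin Z)) -> Z = X.
    move=> ZX Z0 cZ noe; apply: Xmin => //; rewrite /P Z0 (subset_trans ZX XW) /=.
    apply: leq_trans cZ; apply: subset_leq_card; apply/subsetP=> e /(outY _ _ ZX).
    by case/orP=> // /andP[/noe/andP[/negPf -> /negPf ->]].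
  have [/existsP[e0 /andP[e0X e0Y]]|/existsPn noe] :=
      boolP [exists e, (e \in out X) && ((s e \in Y) || (t e \in Y))].
    have cutYC e : (e \in cut (X :\: Y) :&: K) = (e \in cut Y :&: K).
      rewrite !inE; case: (s e \in X); case: (t e \in X); rewrite ?andbF //=.
      by rewrite !andbT addbN addNb negbK.
    have XYE : X :\: Y = X.
      apply: noZ; rewrite ?subsetDl //.
      - by rewrite setD_eq0; apply: contra YnX => XY; rewrite eqEsubset YX.
      - by rewrite (eq_card cutYC).
      move=> e eX; rewrite -(card_le1_eqP Xout _ _ eX e0X).
      have := (subsetP YX (s e0), subsetP YX (t e0)).
      move: e0X e0Y; rewrite !inE.
      case: (s e0 \in X); case: (t e0 \in X); rewrite ?andbF //= => _.
        by case: (t e0 \in Y) => [_ [_ /(_ isT)]|] //; rewrite orbF => ->.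
      by case: (s e0 \in Y) => [_ [/(_ isT)]|] //= ->.
    have [v vY] := set0Pn _ Y0; have := subsetP YX v vY.
    by rewrite -XYE inE vY.
  case/eqP: YnX; apply: noZ => // e eX; have := noe e.
  by rewrite eX /= negb_or.
have into_link e : e \in cut X :&: D -> e \notin out X ->
    exists y w, [/\ link y e w, y \in X & w \in W].
  rewrite inE => /andP[ecX eD]; case/cutP: (ecX) => y [w [l yX wX]].
  rewrite !inE in ecX *; rewrite ecX eD /= -negb_or negbK => eW.
  exists y, w; split=> //; case/linkP: l eW (XnW y yX) => -[-> ->].
    by case/orP=> // ->.
  by case/orP=> // ->.
have disX y p : y \in X -> {subset p <= K} -> [disjoint walk_vertices y p & W].
  move=> yX pK; rewrite disjoint_subset; apply/subsetP=> v; rewrite !inE.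
  case/predU1P=> [->|/hasP[e /pK]]; first exact: XnW.
  by rewrite inE => /and3P[_ sX tX] /orP[] /eqP <-; apply: XnW.
(* With no edge from [X] to [W], the cut of [X] in [D] lies in [out X]; [D_cut] makes it empty, and
   summing boundaries over [X] gives conservation at [y]. *)
have [e1|no_into] := pickP [pred e | (e \in cut X :&: D) && (e \notin out X)]; last first.
  have [y yX] := set0Pn _ X0.
  have [|//||h [u [[hD uD bdh bdu nz] _]]] := step y [::]; [exact: walk_nil | exact: disX | ].
  exists h, u; split=> // v vW; have [->|vy] := eqVneq v y; last first.
    by apply: bdu; rewrite in_setU1 negb_or vy.
  have : cut X :&: D = set0.
    apply/eqP; rewrite -cards_eq0; have := D_cut X.
    suff /subset_leq_card : cut X :&: D \subset out X.
      by move=> le; have := leq_trans le Xout; case: #|_| => [|[]].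
    by apply/subsetP=> e eX; have := no_into e; rewrite /= eX /= => /negbFE.
  have := sumX _ u A2 uD => /[swap] ->; rewrite big_set0 (bigD1 y) //= big1 ?addr0 //.
  move=> z /andP[zX zy]; apply: bdu; rewrite in_setU1 negb_or zy; exact: XnW.
case/andP=> e1c e1o.
have [y1 [w1 [l1 y1X w1W]]] := into_link e1 e1c e1o.
have [e1X e1D] : e1 \in cut X /\ e1 \in D by apply/andP; rewrite -in_setI.
(* Adding the excess of [y1] to the label of [e1] moves it into [W]; the new label of [e1] may be
   zero. *)
have fix1 h u : flow_off W h u (y1 |: W) -> exists2 u1 : E -> A,
    forall e, e != e1 -> u1 e = u e &
    (forall e, e \notin D -> u1 e = 0) /\ (forall v, v \notin W -> bd u1 v = 0).
  case=> hD uD bdh bdu nz; exists (fun e => u e + bd u y1 *+ (e == e1)).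
    by move=> e /negPf ->; rewrite addr0.
  split=> [e eD|v vW].
    by rewrite uD // add0r; case: eqP eD => // ->; rewrite e1D.
  rewrite bdD (bd_delta _ _ l1) (negPf (memPn vW _ w1W)) addr0.
  have [<-|vy] := eqVneq y1 v; first exact: A2.
  by rewrite addr0 bdu // in_setU1 negb_or eq_sym vy.
(* With two edges from [X] to [W], a circulation through both and along a closed
   trail in the support of [h] makes them nonzero.  With only one, the cut of [X]
   has exactly two edges, which then carry equal values. *)
have [e2|no_e2] := pickP [pred e | [&& e \in cut X :&: D, e \notin out X & e != e1]].
  case/and3P=> e2c e2o e21.
  have [y2 [w2 [l2 y2X w2W]]] := into_link e2 e2c e2o.
  have [e2X e2D] : e2 \in cut X /\ e2 \in D by apply/andP; rewrite -in_setI.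
  have [|p1 [p2 [pw1 pw2 up]]] := two_disjoint_walks _ cutK y1X y2X.
    by move=> e; rewrite inE => /and3P[].
  have pK e : e \in p1 ++ p2 -> e \in K by apply: walk_sub (walk_cat pw1 pw2).
  have pD : walk D y1 (p1 ++ p2) y1.
    by apply: walk_mono (walk_cat pw1 pw2) _ => e /pK; rewrite inE => /andP[].
  have [h [u [hu ph]]] := step y1 _ pD up (disX _ _ y1X pK).
  have [u1 u1E [u1D bdu1]] := fix1 h u hu.
  case: hu => hD uD bdh bdu nz.
  (* In exponent two, adding [b] kills a label only if it equals [b]. *)
  have [b [b1 b2]] := A3 (u1 e1) (u1 e2).
  have [w [w0 bdw _]] := walk_chain pw1 b.
  have cutNK e : e \in cut X -> e \notin K.
    by rewrite !inE; case: (s e \in X); rewrite ?andbF //= => /negPf ->; rewrite andbF.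
  have w0' e : e \notin p1 ++ p2 -> w e = 0.
    by rewrite mem_cat negb_or => /andP[/w0].
  have cutNp e : e \in cut X -> w e = 0 by move=> eX; apply: w0'; apply: contra (pK e) (cutNK e eX).
  exists h, (fun e => u1 e + (b *+ (e == e1) + (w e + b *+ (e == e2)))).
  split=> // [e eD|v vW|e eD eW he].
  - rewrite u1D // add0r w0'; last by apply: contra eD; apply: walk_sub pD.
    case: eqP eD => [->|_]; rewrite ?e1D // add0r add0r.
    by case: eqP => [->|_]; rewrite ?e2D.
  - rewrite !bdD bdu1 // bdw (bd_delta _ _ l1) (bd_delta _ _ l2) char2N if_same.
    rewrite (negPf (memPn vW _ w1W)) (negPf (memPn vW _ w2W)) !mulr0n !addr0.
    by rewrite add0r -[X in _ + X]addrA A2 addr0 A2.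
  have [ee1|ne1] := eqVneq e e1.
    by rewrite ee1 cutNp // [e1 == _]eq_sym (negPf e21) !addr0 addr_eq0 char2N eq_sym.
  rewrite add0r; have [ee2|ne2] := eqVneq e e2.
    by rewrite ee2 cutNp // !add0r addr_eq0 char2N eq_sym.
  rewrite addr0 w0' ?addr0 ?u1E //; first exact: nz.
  by apply: contra he => /ph.
have [|//||h [u [hu _]]] := step y1 [::]; [exact: walk_nil | exact: disX | ].
have [u1 u1E [u1D bdu1]] := fix1 h u hu.
case: hu => hD uD bdh bdu nz.
exists h, u1; split=> // e eD eW he.
have [->{e eD eW he}|ne1] := eqVneq e e1; last by rewrite u1E //; apply: nz.
have cutXE : cut X :&: D = e1 |: out X.
  apply/setP=> e; rewrite in_setU1; have [->|ne1] := eqVneq e e1; first by rewrite e1c.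
  have := no_e2 e; rewrite /= ne1 andbT; case: (boolP (e \in out X)) => /=.
    by rewrite inE => /andP[-> _].
  by rewrite andbT.
have [|e' e'o] := set0Pn (out X) _.
  by apply: contraNneq (D_cut X) => o0; rewrite cutXE o0 setU0 cards1.
have outE : out X = [set e'].
  by apply/eqP; rewrite eq_sym eqEcard sub1set e'o cards1.
have e'1 : e' != e1 by apply: contraNneq e1o => <-.
have sum2 (C : zmodType) (f : E -> C) : \sum_(e in cut X :&: D) f e = f e1 + f e'.
  by rewrite cutXE outE big_setU1 ?big_set1 // inE eq_sym.
have [e'D e'W] : e' \in D /\ (s e' \notin W) || (t e' \notin W).
  by move: e'o; rewrite !inE => /and3P[/andP[_ ->] -> _].
(* The even set [h] meets the cut of [X] evenly and misses [e1], which touches [W]; hence it misses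
   [e'], so that [u e'] is nonzero. *)
have he' : ~~ h e'.
  have := sumX _ h addbb _; rewrite sum2 big1 // => /(_ _)/eqP.
  have -> : h e1 = false.
    apply/negP=> /hD[_]; case/linkP: l1 => -[-> ->]; by rewrite w1W.
  rewrite add0r => h0; rewrite -(eqP (h0 _)) // => e eD.
  by apply: contraNF eD => /hD[].
apply/eqP=> u10.
have /esym/eqP := sumX _ u1 A2 u1D; rewrite sum2 u10 add0r u1E // big1 => [|v vX].
  by apply/negP; apply: nz.
by apply: bdu1; apply: XnW.
Qed.

Lemma eight_flow_aux : exists (h : E -> bool) (u : E -> A),
  [/\ forall e, h e -> e \in D, forall e, e \notin D -> u e = 0,
      forall v, bd h v = 0, forall v, bd u v = 0 &
      forall e, e \in D -> ~~ h e -> u e != 0].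
Proof.
have [h [u [hD uD bdh bdu nz]]] := flow_off_exists (leqnn #|~: set0|).
exists h, u; split=> // [e /hD[]|v|e eD] //; first by apply: bdu; rewrite inE.
by apply: nz; rewrite ?inE.
Qed.
End EightFlow.

(** Over the four-element group [bool * bool], [h] and the two coordinates of [u] are the three even
    sets. *)
Lemma eight_flow D : (forall S, #|cut S :&: D| != 1%N) ->
  exists H : 'I_3 -> E -> bool,
  [/\ forall i e, H i e -> e \in D, forall i v, bd (H i) v = 0 &
      forall e, e \in D -> exists i, H i e].
Proof.
move=> D_cut.
have A2 (a : bool * bool) : a + a = 0 by case: a => [[] []].
have A3 (a b : bool * bool) : exists c, c != a /\ c != b.
  have [c /andP[? ?]] : exists c, (c != a) && (c != b); last by exists c.
  by case: a b => [[] []] [[] []]; do [by exists (false, false)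
    | by exists (false, true) | by exists (true, false)].
have [h [u [hD uD bdh bdu nz]]] := eight_flow_aux A2 A3 D_cut.
pose H (i : 'I_3) := tnth [tuple h; fst \o u; snd \o u] i.
exists H; split=> [i e|i v|e eD].
- case: i => [[|[|[|//]]] ?] /=; rewrite /H /tnth /=; first exact: hD.
    by apply: contraTT => /uD ->.
  by apply: contraTT => /uD ->.
- case: i => [[|[|[|//]]] ?]; rewrite /H /tnth /=; first exact: bdh.
    by rewrite bd_comp // bdu.
  by rewrite bd_comp // bdu.
have [he|/(nz e eD)] := boolP (h e); first by exists (inord 0); rewrite /H /tnth inordK.
case uE : (u e) => [a b] ab.
have [aT|aF] := boolP a; first by exists (inord 1); rewrite /H /tnth inordK //= uE.
exists (inord 2); rewrite /H /tnth inordK //= uE /=.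
by move: ab aF; case: a b {uE} => [] [].
Qed.

(** Flow arguments see bridges as one-edge cuts; [cut1_bridge] and [bridge_cut1] give the link with
    component counts. *)
Definition bridges : {set E} := [set b | [exists S : {set V}, cut S == [set b]]].

(* The cuts are closed under symmetric difference. *)
Lemma cut_of_bridges (Z : {set E}) : Z \subset bridges -> exists S, cut S = Z.
Proof.
elim: {Z}#|Z| {-2}Z (leqnn #|Z|) => [|n IH] Z.
  rewrite leqn0 cards_eq0 => /eqP -> _; exists set0.
  by apply/setP=> e; rewrite !inE.
have [-> _ _|[b bZ] Zn ZB] := set_0Vmem Z.
  by exists set0; apply/setP=> e; rewrite !inE.
have [|S SE] := IH (Z :\ b) _ (subset_trans (subD1set _ _) ZB).
  by rewrite (cardsD1 b) bZ in Zn.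
have := subsetP ZB b bZ; rewrite inE => /existsP[X /eqP XE].
exists [set v | (v \in S) (+) (v \in X)]; apply/setP=> e.
rewrite (@cut_addb S X) => [|v]; last by rewrite inE.
by rewrite SE XE !inE; case: eqP => [->|_] /=; rewrite ?bZ ?addbF.
Qed.

(** A two-colouring can thus be altered at will on bridges and nowhere else. *)
Lemma cut_flip X (Z : {set E}) : Z \subset bridges ->
  exists Y, forall e, (e \in cut Y) = (e \in cut X) (+) (e \in Z).
Proof.
move=> /cut_of_bridges[S <-]; exists [set v | (v \in X) (+) (v \in S)].
by apply: cut_addb => v; rewrite inE.
Qed.

(** If [e] were the only non-bridge in a cut, flipping the bridges of that cut would leave [e]
    alone, making it a bridge after all. *)
Lemma cut_nonbridges S : #|cut S :&: ~: bridges| != 1%N.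
Proof.
apply/negP=> /cards1P[e eE].
have [Y YE] := cut_flip S (subsetIr (cut S) bridges).
have /setP/(_ e) := eE; rewrite !inE eqxx => /andP[_ /existsP[]].
exists Y; apply/eqP/setP=> e'; rewrite YE -eE !inE.
by case: ((s e' \in S) (+) (t e' \in S)).
Qed.

End Boundary.

(** * Covering the bridges *)

Section Lift.
Import GRing.Theory.
Local Open Scope ring_scope.
Variables (V E : finType) (s t : E -> V).
Implicit Types (S X Y : {set V}) (x y v : V).
Notation bd := (boundary s t).
Notation cut := (edge_cut s t).
Notation B := (bridges s t).
Notation walk := (walk s t (~: B)).

Lemma bd_map (T : finType) (r : V -> T) (A : zmodType) (u : E -> A) z :
  boundary (r \o s) (r \o t) u z = \sum_(y | r y == z) bd u y.
Proof.
transitivity (\sum_(y in [set y | r y == z]) bd u y); last first.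
  by apply: eq_bigl => y; rewrite inE.
by rewrite sum_bd; apply: eq_bigr => e _; rewrite !inE.
Qed.

Definition block_step : rel V := [rel x y | [exists e, (e \notin B) && link s t x e y]].
Definition block : V -> V := fingraph.root block_step.
(** This says that the block of [v] is not bipartite; by [odd_block_eq] the choice of [v] in the
    block is immaterial. *)
Definition odd_block v : bool := `[< exists2 p, walk v p v & odd (size p) >].

Lemma block_sym : connect_sym block_step.
Proof.
by apply: sym_connect_sym => x y /=; apply: eq_existsb => e; rewrite linkC.
Qed.

Lemma walk_block x p y : walk x p y -> block x = block y.
Proof.
elim=> {x p y} // x e y p z eB l _ <-.
apply/(fingraph.rootP block_sym)/connect1/existsP; exists e.
by rewrite in_setC in eB; rewrite eB.
Qed.

Lemma block_walk x y : block x = block y -> exists p, walk x p y.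
Proof.
move/(fingraph.rootP block_sym)/connectP=> [p pp ->].
elim: p x pp => [|z p IH] x /=; first by exists [::]; apply: walk_nil.
case/andP=> /existsP[e /andP[eB l]] /IH[q qw]; exists (e :: q).
by apply: walk_cons l qw; rewrite in_setC.
Qed.

Lemma link_block e : e \notin B -> block (s e) = block (t e).
Proof.
move=> eB; apply: (@walk_block _ [:: e]); apply: walk1; rewrite ?in_setC //.
by rewrite /link !eqxx.
Qed.

Lemma odd_block_eq x y : block x = block y -> odd_block x = odd_block y.
Proof.
suff imp x' y' : block x' = block y' -> odd_block x' -> odd_block y'.
  by move=> xy; apply/idP/idP; apply: imp.
move=> /esym/block_walk[q qw] /asboolP[p pw po]; apply/asboolP.
exists (q ++ p ++ rev q); first exact: walk_cat qw (walk_cat pw (walk_rev qw)).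
by rewrite !size_cat size_rev !oddD po addbCA addbb.
Qed.

(** No side of a bridge has a proper two-colouring; a single vertex has one vacuously, which covers
    the [K1] alternative. *)
Hypothesis not_bip : forall S b, cut S = [set b] ->
  ~ exists X, forall e, s e \in S -> t e \in S -> e \in cut X.

Definition contract v : option V := if odd_block v then None else Some (block v).

Lemma contract_eq x y : block x = block y -> contract x = contract y.
Proof. by rewrite /contract => xy; rewrite (odd_block_eq xy) xy. Qed.

(** Colour each vertex by the parity of walks from the root of its block; in a bipartite block, an
    edge with equal colours at its ends would close an odd walk. *)
Lemma two_coloring : exists X, forall e, e \notin B -> ~~ odd_block (s e) ->
  e \in cut X.
Proof.
exists [set v | `[< exists2 p, walk (block v) p v & ~~ odd (size p) >]].
move=> e eB noS.
have bb := link_block eB.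
have eD : e \in ~: B by rewrite in_setC.
have est : link s t (s e) e (t e) by apply/linkP; left.
have closed p q : walk (block (s e)) p (s e) -> walk (block (s e)) q (t e) ->
    odd (size p) (+) odd (size q).
  move=> pw qw; apply: contraNT noS => par; apply/asboolP.
  exists (e :: rev q ++ p).
    by apply: walk_cons est (walk_cat (walk_rev qw) pw).
  by rewrite /= size_cat size_rev oddD addbC par.
have [p pw] : exists p, walk (block (s e)) p (s e).
  by apply: block_walk; apply: (root_root block_sym).
have [q qw] : exists p, walk (block (s e)) p (t e).
  by apply: block_walk; rewrite -bb; apply: (root_root block_sym).
have odds := closed _ _ pw qw.
rewrite !inE -bb.
case: asboolP => [[p' pw' ep']|noe]; case: asboolP => [[q' qw' eq']|noo] //=.
  by have := closed _ _ pw' qw'; rewrite (negPf ep') (negPf eq').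
have op : odd (size p) by apply: contra_notT noe; exists p.
have oq : odd (size q) by apply: contra_notT noo; exists q.
by rewrite op oq in odds.
Qed.

(** Take the side free of [None]. If one bridge alone left it, its preimage would consist of
    bipartite blocks joined by bridges, and flipping a two-colouring of the blocks on the
    monochromatic bridges would colour it properly. *)
Lemma contract_cut (S : {set option V}) :
  #|edge_cut (contract \o s) (contract \o t) S :&: B| != 1%N.
Proof.
wlog NS : S / None \notin S => [hw|].
  have [NS|/hw//] := boolP (None \in S).
  by have := hw (~: S); rewrite cutC inE NS => /(_ isT).
apply/negP=> /cards1P[b bE].
have [X XE] := two_coloring.
have bB : b \in B by have /setP/(_ b) := bE; rewrite !inE eqxx => /andP[].
pose S' := [set v | contract v \in S].
have S'E : cut S' = [set b].
  rewrite -bE; apply/setP=> e; rewrite !inE /=.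
  case: (boolP [exists _, _]) => eB; rewrite ?andbT ?andbF //.
  rewrite (@contract_eq (s e) (t e)) ?addbb //.
  by apply: link_block; rewrite inE.
have [Y YE] := @cut_flip _ _ s t X (B :\: cut X) (subsetDl _ _).
case: (not_bip S'E); exists Y => e sS tS; rewrite YE in_setD.
have [eX|eX] //= := boolP (e \in cut X).
have [//|eB] := boolP (e \in B).
case/negP: eX; apply: XE => //; apply: contra NS => ob.
by move: sS; rewrite inE /contract ob.
Qed.

(** As [a] doubles to zero, vertex excesses are their own negatives and can be gathered at block
    roots. All corrections run along walks that avoid bridges, so the labels of bridges stay
    fixed. *)
Lemma bridge_lift (R : zmodType) (q : R) (c : E -> bool) : q *+ 4 = 0 ->
  (forall e, c e -> e \in B) ->
  (forall z, boundary (contract \o s) (contract \o t) c z = 0) ->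
  exists g : E -> R, (forall v, bd g v = 0) /\ {in B, forall e, g e = q *+ 2 *+ c e}.
Proof.
move=> q4 cB bdc; pose a := q *+ 2.
have a2 : a + a = 0 by rewrite -mulr2n -mulrnA.
have f0 : a *+ false = 0 by [].
have fD : {morph (fun b : bool => a *+ b) : x y / x + y}.
  by case=> [] [] //=; rewrite ?a2 ?addr0 ?add0r.
pose m v := a *+ bd c v.
have bda v : bd ((fun b : bool => a *+ b) \o c) v = m v by rewrite bd_comp.
have mN v : - m v = m v.
  by apply/eqP; rewrite eq_sym -addr_eq0 /m; case: (bd c v); rewrite ?a2 ?addr0.
have [|w [w0 bdw]] := @gather_boundary _ _ s t R (~: B) block m _ mN.
  by move=> y _; apply: block_walk; rewrite [in RHS]/block (root_root block_sym).
pose par v := \sum_(y | block y == v) bd c y.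
have parE v : \sum_(y | block y == v) m y = a *+ par v.
  by rewrite /par (big_morph _ fD f0).
(* Only roots collect anything, and for a bipartite block the total is the boundary of [c] at a
   vertex of the contracted graph. *)
have par0 v : ~~ odd_block v -> par v = 0.
  move=> nov; have [bv|bv] := eqVneq (block v) v; last first.
    rewrite /par big_pred0 // => y; apply: contraNF bv => /eqP <-.
    by rewrite /block (root_root block_sym).
  rewrite -(bdc (contract v)) bd_map; apply: eq_bigl => y.
  apply/eqP/eqP => [yv|]; first by apply: contract_eq; rewrite bv.
  rewrite /contract (negPf nov); case: ifP => // _ [->] //.
(* Alternating labels [q], [- q] along an odd closed walk leave [q + q = a] at its base, cancelling
   what was gathered there. *)
have /choice[f fP] (v : V) : exists u : E -> R,
    [/\ forall e, e \notin ~: B -> u e = 0 &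
        forall v', bd u v' = a *+ (par v && odd_block v) *+ (v == v')].
  have [pv|_] := boolP (par v && odd_block v); last first.
    by exists (fun=> 0); split=> // v'; rewrite mul0rn bd_eq0.
  have /andP[_ /asboolP[p pw po]] := pv.
  have [u [u0 bdu _]] := walk_chain pw q; exists u; split=> [e eD|v'].
    by apply: u0; apply: contra eD; apply: walk_sub pw.
  by rewrite bdu po -mulrnDl.
exists (fun e => a *+ c e + (w e + \sum_v f v e)); split=> [v|e eB].
  rewrite !bdD bda bdw parE bd_sum (eq_bigr _ (fun v' _ => proj2 (fP v') v)).
  rewrite (bigD1 v) //= big1 => [|v' /negPf -> //]; rewrite eqxx addr0 mulr1n.
  have -> : par v && odd_block v = par v.
    by have [_|/par0->] := boolP (odd_block v); rewrite ?andbT.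
  by rewrite -addrA -mulrnDl a2 mul0rn addr0 -mulrnDl a2 mul0rn.
rewrite w0 ?in_setC ?eB // big1 ?addr0 // => v _.
by case: (fP v) => f0' _; apply: f0'; rewrite in_setC eB.
Qed.

(** The first three coordinates deal with the non-bridges, where even sets scaled by [q *+ 2] are
    zero-sum; the last three deal with the bridges. *)
Lemma six_flows (R : zmodType) (q : R) : q *+ 4 = 0 -> q *+ 2 != 0 ->
  exists phi : E -> {ffun 'I_6 -> R},
    (forall v, bd phi v = 0) /\ (forall e, phi e != 0).
Proof.
move=> q4 q2.
have [H [_ bdH Hcov]] := eight_flow (@cut_nonbridges _ _ s t).
have [c [cB bdc ccov]] := eight_flow contract_cut.
have /choice[g gP] i := bridge_lift q4 (cB i) (bdc i).
have fD : {morph (fun b : bool => q *+ 2 *+ b) : x y / x + y}.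
  have a2 : q *+ 2 + q *+ 2 = 0 by rewrite -mulr2n -mulrnA.
  by case=> [] [] //=; rewrite ?a2 ?addr0 ?add0r.
exists (fun e => [ffun i : 'I_(3 + 3) =>
  match split i with inl j => q *+ 2 *+ H j e | inr j => g j e end]).
split=> [v|e].
  apply/ffunP=> i; rewrite [RHS]ffunE.
  have at0 : (0 : {ffun 'I_(3 + 3) -> R}) i = 0 by rewrite ffunE.
  have atD : {morph (fun x : {ffun 'I_(3 + 3) -> R} => x i) : x y / x + y}.
    by move=> x y; rewrite ffunE.
  rewrite -(bd_comp s t _ v at0 atD).
  case iE: (@split 3 3 i) => [j|j].
    transitivity (q *+ 2 *+ bd (H j) v); last by rewrite bdH.
    rewrite -(@bd_comp _ _ s t _ _ (fun b : bool => q *+ 2 *+ b) _ _ erefl fD).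
    by apply: bd_eq => e _; rewrite /= ffunE iE.
  rewrite -[RHS](proj1 (gP j) v).
  by apply: bd_eq => e _; rewrite /= ffunE iE.
apply/eqP=> /ffunP phi0; have [eB|eB] := boolP (e \in B).
  have [i ci] := ccov e eB; have := phi0 (rshift 3 i).
  rewrite !ffunE (unsplitK (inr i)) (proj2 (gP i)) // ci.
  by move/eqP: q2.
have [i Hi] : exists i, H i e by apply: Hcov; rewrite in_setC.
have := phi0 (lshift 3 i); rewrite !ffunE (unsplitK (inl i)) Hi.
by move/eqP: q2.
Qed.
End Lift.

(** * Components and bridges of multigraphs *)

Lemma connect_adj_sym (G : mgraph) : connect_sym (@adj G).
Proof.
by apply: sym_connect_sym => x y; apply: eq_existsb => e; rewrite setUC.
Qed.

Lemma componentsP (G : mgraph) (S : {set vertex G}) :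
  reflect (exists x, S = [set y | connect (@adj G) x y]) (S \in components G).
Proof.
apply: (iffP imsetP) => [[x _ ->]|[x ->]]; exists x => //; first by apply/setP=> y; rewrite !inE.
by apply/setP=> y; rewrite !inE.
Qed.

Lemma component_eq (G : mgraph) (x y : vertex G) : connect (@adj G) x y ->
  [set z | connect (@adj G) x z] = [set z | connect (@adj G) y z].
Proof.
move=> xy; apply/setP=> z; rewrite !inE.
by rewrite (same_connect (@connect_adj_sym G) xy).
Qed.

Lemma connected_connect (G : mgraph) : connected_graph G ->
  forall x y : vertex G, connect (@adj G) x y.
Proof.
move=> /eqP/cards1P[S SE] x y.
have compS z : [set z' | connect (@adj G) z z'] = S.
  by apply/eqP; rewrite -in_set1 -SE; apply/componentsP; exists z.
have : y \in [set z | connect (@adj G) x z] by rewrite compS -(compS y) inE.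
by rewrite inE.
Qed.

Lemma connect_closed (T : finType) (e : rel T) (S : {set T}) x y :
  (forall u v, e u v -> u \in S -> v \in S) ->
  connect e x y -> x \in S -> y \in S.
Proof.
move=> cl /connectP[p + ->]; elim: p x => //= z p IH x /andP[/cl xz /IH zp] /xz.
exact: zp.
Qed.

(** * Bridges and bipartite sides in terms of end functions *)

Section Ends.
Variables (G : mgraph) (s t : edge G -> vertex G).
Hypothesis st_ends : forall e, ends e = [set s e; t e].
Hypothesis st_neq : forall e, s e != t e.
Notation cut := (edge_cut s t).
Notation link := (link s t).

Lemma ends_link e x y : (ends e == [set x; y]) = link x e y.
Proof.
apply/eqP/linkP => [|[[<- <-]|[<- <-]]]; rewrite st_ends //; last by rewrite setUC.
move=> /setP eE.
have := eE (s e); have := eE (t e); have := eE x; have := eE y.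
rewrite !inE !eqxx ?orbT /= => + + /esym/orP[]/eqP tE /esym/orP[]/eqP sE;
  rewrite ?sE ?tE; auto; have := st_neq e; by rewrite sE tE eqxx.
Qed.

Lemma adj_link x y : adj x y = [exists e, link x e y].
Proof. by apply: eq_existsb => e; rewrite ends_link. Qed.

Lemma sum_ends (A : zmodType) (u : edge G -> A) v :
  (\sum_(e : edge G | v \in ends e) u e)%R = boundary s t u v.
Proof.
rewrite big_mkcond; apply: eq_bigr => e _; rewrite st_ends !inE ![v == _]eq_sym.
case: (eqVneq (s e) v) (st_neq e) => [<-|_ _] /=.
  by rewrite eq_sym => /negPf ->; rewrite GRing.mulr0n GRing.addr0.
by rewrite GRing.mulr0n GRing.add0r; case: eqP.
Qed.

Lemma adj_del b (x y : vertex G) :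
  reflect (exists2 e, e != b & link x e y) (@adj (del_edge b) x y).
Proof.
apply: (iffP existsP) => [[[e eb] /= exy]|[e eb exy]].
  by exists e; rewrite // -ends_link.
by exists (Sub e eb); rewrite /= /del_ends /= ends_link.
Qed.

Hypothesis G_conn : connected_graph G.

Lemma cut0_setT (S : {set vertex G}) x : x \in S -> cut S = set0 -> S = setT.
Proof.
move=> xS S0; apply/setP=> y; rewrite inE; apply: connect_closed xS;
  last exact: (connected_connect G_conn x y).
move=> u v; rewrite adj_link => /existsP[e l] uS; apply/negPn/negP=> vS.
by have : e \in cut S; [apply/cutP; exists u, v | rewrite S0 inE].
Qed.

(** Without [b] no edge joins [S] to its complement, while paths of [G] from [p] show that every
    vertex remains reachable from [p] or [p']; so these two sets are the components. *)
Lemma cut1_bridge (S : {set vertex G}) b : cut S = [set b] ->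
  is_bridge b /\ S \in components (del_edge b).
Proof.
move=> Sb; have /cutP[p [p' [l pS p'S]]] : b \in cut S by rewrite Sb inE.
pose R := @adj (del_edge b).
have RS x y : connect R x y -> (x \in S) = (y \in S).
  have RS1 S' : cut S' = [set b] -> connect R x y -> x \in S' -> y \in S'.
    move=> S'b; apply: connect_closed => u v /adj_del[e eb ll] uS.
    apply: contraNT eb => vS; rewrite -in_set1 -S'b; apply/cutP.
    by exists u, v.
  move=> xy; apply/idP/idP; first exact: RS1.
  by apply: contraTT; rewrite -!in_setC; apply: RS1; rewrite ?cutC.
have pp' x : connect R p x || connect R p' x.
  have : x \in [set x | connect R p x || connect R p' x].
    apply: connect_closed (connected_connect G_conn p x) _; last by rewrite inE connect0.
    move=> u v; rewrite adj_link !inE => /existsP[e ll].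
    have [eb _|eb] := eqVneq e b.
      rewrite eb in ll; have /orP[/eqP->|/eqP->] : (v == p) || (v == p').
        by case/linkP: ll => -[? ?]; case/linkP: l => -[? ?]; subst; rewrite eqxx ?orbT.
        by rewrite connect0.
      by rewrite connect0 orbT.
    have uv : connect R u v by apply/connect1/adj_del; exists e.
    by case/orP=> /connect_trans/(_ uv) ->; rewrite ?orbT.
  by rewrite inE.
have SE : S = [set x | connect R p x].
  apply/setP=> x; rewrite inE; apply/idP/idP => [xS|/RS <- //].
  by case/orP: (pp' x) => // /RS; rewrite xS (negPf p'S).
have SCE : ~: S = [set x | connect R p' x].
  apply/setP=> x; rewrite !inE; apply/idP/idP => [xS|/RS <- //].
  by case/orP: (pp' x) => // /RS; rewrite pS (negPf xS).
have Sc : S \in components (del_edge b) by apply/componentsP; exists p.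
split=> //; rewrite /is_bridge G_conn.
have -> : components (del_edge b) = [set S; ~: S].
  apply/setP=> C; rewrite !inE; apply/componentsP/orP=> [[x ->]|[]/eqP->].
  - case/orP: (pp' x) => /(@component_eq (del_edge b)) <-; first by left; rewrite SE.
    by right; rewrite SCE.
  - by exists p.
  by exists p'.
rewrite cards2; case: eqP => // /setP/(_ p).
by rewrite inE pS.
Qed.

(** Only [b] can leave a component of [del_edge b]. If nothing did, connectedness would make it the
    only component, against the count. *)
Lemma bridge_cut1 (S : {set vertex G}) b : is_bridge b -> S \in components (del_edge b) ->
  cut S = [set b].
Proof.
rewrite /is_bridge G_conn => b2 /componentsP[x SE].
have xS : x \in S by rewrite SE inE connect0.
have cutb e : e \in cut S -> e = b.
  case/cutP=> u [v [l uS vS]]; apply/eqP; apply: contraNT vS => eb.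
  move: uS; rewrite SE !inE => /connect_trans; apply; apply: connect1.
  by apply/adj_del; exists e.
have [S0|[e eS]] := set_0Vmem (cut S); last first.
  apply/setP=> e'; rewrite inE; apply/idP/eqP => [/cutb//|->].
  by rewrite -(cutb e eS).
have ST := cut0_setT xS S0.
suff : components (del_edge b) = [set S] by move=> E; rewrite E cards1 in b2.
apply/setP=> C; rewrite inE; apply/componentsP/eqP => [[y ->]|->]; last by exists x.
rewrite SE; apply/esym/(@component_eq (del_edge b)).
by have := in_setT y; rewrite -ST SE inE.
Qed.

Lemma induced_ends b (S : {set vertex G}) (e : edge (induced (G := del_edge b) S)) :
  exists x y : vertex (induced (G := del_edge b) S),
    [/\ ends e = [set x; y], val x = s (val (val e)) & val y = t (val (val e))].
Proof.
have := valP e; rewrite /= /del_ends st_ends subUset !sub1set => /andP[sS tS].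
exists (exist (fun v => v \in S) _ sS), (exist (fun v => v \in S) _ tS); split=> //.
by apply/setP=> v; rewrite !inE /= /del_ends st_ends !inE.
Qed.

(** As [b] has just one end in [S], deleting it loses no edge inside [S]. *)
Lemma bipartite_induced b (S : {set vertex G}) : b \in cut S ->
  bipartite (induced (G := del_edge b) S) <->
  exists X, forall e, s e \in S -> t e \in S -> e \in cut X.
Proof.
move=> bS; split=> [[X0 X0P]|[X XE]].
  exists (val @: X0) => e sS tS.
  have eb : e != b.
    by apply: contraTneq bS => <-; rewrite inE sS tS.
  have eS : @ends (del_edge b) (Sub e eb) \subset S.
    by rewrite /= /del_ends /= st_ends subUset !sub1set sS.
  have [x [y [E xE yE]]] := @induced_ends b S (exist _ (Sub e eb) eS).
  have [X1 _] := X0P (exist _ (Sub e eb) eS).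
  rewrite /= in xE yE; rewrite inE -xE -yE !(mem_imset _ _ val_inj).
  rewrite E in X1; have xy : x != y.
    by apply: contra (st_neq e) => /eqP xy; rewrite -xE -yE xy.
  move: X1; case: (boolP (x \in X0)) => xX; case: (boolP (y \in X0)) => yX //.
    rewrite (setIidPl _) ?cards2 ?xy //.
    by rewrite subUset !sub1set xX.
  rewrite (_ : _ :&: _ = set0) ?cards0 //; apply/setP=> z; rewrite !inE.
  by apply/andP=> -[/orP[]/eqP->]; apply/negP.
exists [set v | val v \in X] => e.
have [x [y [E xE yE]]] := induced_ends e.
have [xS yS] := (valP x, valP y).
have pairI (T : finType) (a a' : T) (Y : {set T}) :
    a \in Y -> a' \notin Y -> #|[set a; a'] :&: Y| = 1.
  move=> aY a'Y; rewrite (_ : _ :&: _ = [set a]) ?cards1 //.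
  apply/setP=> z; rewrite !inE; case: eqP => [->|_] //=.
  by apply/andP=> -[/eqP ->]; apply/negP.
rewrite E; have := XE (val (val e)).
rewrite inE -xE -yE => /(_ xS yS).
have := fun Y => @pairI _ x y Y; have := fun Y => @pairI _ y x Y.
rewrite [[set y; x]]setUC.
case: (boolP (val x \in X)) => xX; case: (boolP (val y \in X)) => //= yX P1 P2 _.
  by split; [apply: P2|apply: P1]; rewrite !inE ?negbK.
by split; [apply: P1|apply: P2]; rewrite !inE ?negbK.
Qed.

(** In the [K1] case [S] spans no edge, so any [X] will do. *)
Lemma bip_or_K1_induced b (S : {set vertex G}) : b \in cut S ->
  bipartite (induced (G := del_edge b) S) \/
    graph_iso (induced (G := del_edge b) S) K1 ->
  exists X, forall e, s e \in S -> t e \in S -> e \in cut X.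
Proof.
move=> bS [/(bipartite_induced bS)//|[_ [g _]]].
exists set0 => e sS tS.
have eb : e != b by apply: contraTneq bS => <-; rewrite inE sS tS.
have eS : @ends (del_edge b) (Sub e eb) \subset S.
  by rewrite /= /del_ends /= st_ends subUset !sub1set sS.
by case: (g (exist _ (Sub e eb) eS)).
Qed.

Lemma bipartite_side_eq0 (A : zmodType) (phi : edge G -> A) b
    (S X : {set vertex G}) : cut S = [set b] ->
  (forall e, s e \in S -> t e \in S -> e \in cut X) ->
  (forall v, boundary s t phi v = 0)%R -> phi b = 0%R.
Proof.
move=> Sb XE bd0.
have sum0 (Y : {set vertex G}) : (\sum_(v in Y) boundary s t phi v = 0)%R by apply: big1.
(* Each edge inside [S] contributes equally to the two sums, so only [b] survives in the
   difference. *)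
have := congr2 (fun x y => x - y)%R (sum0 (S :&: X)) (sum0 (S :\: X)).
rewrite /= !sum_bd -GRing.sumrB GRing.subr0 (bigD1 b) //= big1 => [|e eb].
  have := set11 b; rewrite -Sb !inE GRing.addr0.
  case: (s b \in S); case: (t b \in S) => //= _; case: (_ \in X);
    rewrite /= ?andbF !(GRing.mulr0n, GRing.mulr1n, GRing.addr0, GRing.add0r, GRing.subr0) //;
    by move/eqP; rewrite ?GRing.oppr_eq0 => /eqP.
have : e \notin cut S by rewrite Sb inE.
have := XE e; rewrite !inE.
case: (s e \in S); case: (t e \in S) => //=; last by rewrite !andbF !GRing.addr0 GRing.subrr.
move=> /(_ isT isT) + _; case: (s e \in X); case: (t e \in X) => //= _;
  by rewrite /= !(GRing.mulr0n, GRing.addr0, GRing.add0r) GRing.subrr.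
Qed.

End Ends.

(** Any choice of order works, since cuts and boundaries are symmetric in [s] and [t]. *)
Lemma mgraph_ends (G : mgraph) : exists s t : edge G -> vertex G,
  (forall e, ends e = [set s e; t e]) /\ (forall e, s e != t e).
Proof.
have /choice[f fP] (e : edge G) : exists p : vertex G * vertex G,
    p.1 != p.2 /\ ends e = [set p.1; p.2].
  have /eqP/cards2P[x [y [xy eE]]] := card_ends e.
  by exists (x, y).
by exists (fun e => (f e).1), (fun e => (f e).2); split=> e; case: (fP e).
Qed.

(** * The obstruction, and the labelling over ['Z_(2 * j)] *)

Theorem theorem3p3 (j : nat) (j_gt0 : 0 < j) (j_even : ~~ odd j)
    (G : mgraph) (G_conn : connected_graph G)
    (G_bridge : exists b : edge G, is_bridge b) :
  (~ (exists b : edge G, is_bridge b /\ has_bip_or_K1_component (del_edge b)) ->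
     zeta_le (zeta j G) 6)
  /\
  ((exists b : edge G, is_bridge b /\ has_bip_or_K1_component (del_edge b)) ->
     ~ (exists A : finZmodType, 1 < #|A| /\ zero_sum_magic A G)).
Proof.
have [s [t [st_ends st_neq]]] := mgraph_ends G.
split=> [nobip|[b [bridge_b [S Sb bipS]]] [A [_ [phi [phi0 sum0]]]]]; last first.
  have Scut := bridge_cut1 st_ends st_neq G_conn bridge_b Sb.
  have bS : b \in edge_cut s t S by rewrite Scut inE.
  have [X XE] := bip_or_K1_induced st_ends st_neq bS bipS.
  apply: (phi0 b); apply: (bipartite_side_eq0 Scut XE) => v.
  by rewrite -(sum_ends st_ends st_neq).
(* Since [j] is even, [j./2] is an exact half: [q *+ 4] is [2 * j], hence zero, while [q *+ 2] is
   [j], of order two. *)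
pose q : 'Z_(2 * j) := (j./2%:R)%R.
have jE : j = (j./2).*2 by rewrite -[LHS]odd_double_half (negPf j_even).
have q2 : (q *+ 2 = j%:R)%R by rewrite -GRing.mulrnA muln2 -jE.
(* ['Z_n] has modulus [n] only for [n > 1]. *)
have m_gt1 : 1 < 2 * j by apply: (@leq_trans (2 * 1)) => //; rewrite leq_mul2l.
have q4 : (q *+ 4 = 0)%R.
  by rewrite -[4]/(2 * 2) GRing.mulrnA q2 -GRing.mulrnA [(j * 2)%N]mulnC pchar_Zp.
have q20 : (q *+ 2 != 0)%R.
  rewrite q2; apply/eqP=> /(congr1 (@nat_of_ord _)).
  rewrite val_Zp_nat // modn_small ?ltn_Pmull //= => j0.
  by rewrite j0 in j_gt0.
have not_bip (S : {set vertex G}) b : edge_cut s t S = [set b] ->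
    ~ exists X, forall e, s e \in S -> t e \in S -> e \in edge_cut s t X.
  move=> Sb col; apply: nobip; exists b.
  have [bridge_b Sc] := cut1_bridge st_ends st_neq G_conn Sb; split=> //.
  exists S => //; left; apply/(bipartite_induced st_ends st_neq) => //.
  by rewrite Sb inE.
have [phi [bd0 phi0]] := six_flows not_bip q4 q20.
have z6 : zeta_pred j G 6.
  apply/andP; split=> //; apply/asboolP; exists phi; split=> [e|v].
    exact/eqP.
  by rewrite (sum_ends st_ends st_neq).
rewrite /zeta; case: pselect => [ex|[]]; last by exists 6.
by rewrite /zeta_le; case: ex_minnP => c _; apply.
Qed.
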